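(* Let $G$ be a connected simple graph having a vertex $w$ such that: (i) $G-w$ is bipartite; (ii) $w$ has degree $4$ and every other vertex of $G$ has degree $3$; (iii) for a bipartition $X,Y$ of $G-w$, $w$ is joined to $X$ by exactly two edges and to $Y$ by exactly two edges. Then $\chi'_o(G)=4$.
   Context: All graphs are finite and simple. For a graph $G$, a subgraph $H$ is an odd subgraph if every vertex of $H$ has odd degree in $H$. $G$ is odd $k$-edge-colorable if there is a map $c:E(G)\to\{1,\dots,k\}$ such that for each $i$ with $c^{-1}(i)\neq\emptyset$, the subgraph formed by the edge set $c^{-1}(i)$ (together with the endpoints of those edges) is an odd subgraph of $G$. The odd chromatic index $\chi'_o(G)$ is the minimum $k$ such that $G$ is odd $k$-edge-colorable. *)

(* Defs.v *)
From HB Require Import structures.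
From mathcomp Require Import all_boot.

Set Implicit Arguments.
Unset Strict Implicit.
Unset Printing Implicit Defensive.

Record sgraph := SGraph {
  vertex :> finType;
  adj : rel vertex;
  adj_sym : symmetric adj;
  adj_irrefl : irreflexive adj }.

Definition degree (G : sgraph) (v : G) : nat := #|[set u | adj v u]|.

Definition connected (G : sgraph) : Prop :=
  0 < #|G| /\ forall x y : G, connect (@adj G) x y.

(* The vertices of G - w form a subtype of those of G; val embeds them in G. *)
Section DeleteVertex.
Variables (G : sgraph) (w : G).

Definition del_adj : rel {x : G | x != w} := fun x y => adj (val x) (val y).

Lemma del_adj_sym : symmetric del_adj.
Proof. by move=> x y; apply: adj_sym. Qed.

Lemma del_adj_irrefl : irreflexive del_adj.
Proof. by move=> x; apply: adj_irrefl. Qed.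

Definition del_vertex : sgraph := SGraph del_adj_sym del_adj_irrefl.

End DeleteVertex.

Definition bipartition (G : sgraph) (X Y : {set G}) : Prop :=
  [/\ X :|: Y = [set: G], [disjoint X & Y] &
      forall x y : G, adj x y ->
        (x \in X) && (y \in Y) || (x \in Y) && (y \in X)].

Definition bipartite (G : sgraph) : Prop :=
  exists X Y : {set G}, bipartition X Y.

Definition edges (G : sgraph) : {set {set G}} :=
  [set [set p.1; p.2] | p : G * G & adj p.1 p.2].

Definition edge (G : sgraph) := {f : {set G} | f \in edges G}.

(* A subgraph is given by its vertex set V and its edge set F. *)
Definition odd_subgraph (G : sgraph) (V : {set G}) (F : {set {set G}}) : bool :=
  [forall v in V, odd #|[set f in F | v \in f]|].

Definition color_class (G : sgraph) (k : nat) (c : {ffun edge G -> 'I_k})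
    (i : 'I_k) : {set {set G}} :=
  [set val f | f : edge G & c f == i].

(* cover F is the set of endpoints of the edges in F. *)
Definition odd_edge_coloring (G : sgraph) (k : nat)
    (c : {ffun edge G -> 'I_k}) : bool :=
  [forall i : 'I_k, (color_class c i != set0) ==>
     odd_subgraph (cover (color_class c i)) (color_class c i)].

Definition odd_edge_colorable (G : sgraph) (k : nat) : bool :=
  [exists c : {ffun edge G -> 'I_k}, odd_edge_coloring c].

(* Giving each edge its own color makes every color class a single edge. *)
Lemma odd_edge_colorable_exists (G : sgraph) :
  exists k, odd_edge_colorable G k.
Proof.
exists #|{: edge G}|; apply/existsP.
exists [ffun f => enum_rank f]; apply/forallP => i; apply/implyP => _.
have -> : color_class [ffun f : edge G => enum_rank f] i
          = [set val (enum_val i)].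
  apply/setP => f; rewrite inE; apply/imsetP/eqP.
    by case=> g; rewrite inE ffunE => /eqP <- ->; rewrite enum_rankK.
  by move=> ->; exists (enum_val i); rewrite // inE ffunE enum_valK.
apply/forallP => v; apply/implyP; rewrite /cover big_set1 => vi.
rewrite (_ : [set f in _ | _] = [set val (enum_val i)]) ?cards1 //.
apply/setP => f; rewrite !inE.
by case: eqP => // ->; rewrite vi.
Qed.

Definition odd_chromatic_index (G : sgraph) : nat :=
  ex_minn (odd_edge_colorable_exists G).

(* Main.v *)
(* With at most three colors, the vertices other than w see either one color
   three times or three colors once, so all their color degrees agree modulo 3.
   Double counting the edges between the two sides of G - w then shows that,
   modulo 3, the number of edges of color i from w to one side minus the number
   to the other side does not depend on i.  This is impossible, since the color
   degrees at w are 3, 1 and 0.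

   With four colors, take a proper 3-edge-coloring of G - w (Koenig), and let
   m v < 3 be a color missing at the neighbor v of w.  If, apart from one
   neighbor t, the values of m are all equal or all distinct, color wt with 3 and
   every other wv with m v.  Otherwise m takes two values twice each, say
   m t = m u and m v = m x; let c0 be the third color.  Swapping t and u if needed,
   t is not joined to x by an edge of color c0.  Recolor the c0-edge at x (if any)
   with 3, and give wt, wu, wv, wx the colors 3, m u, m v, c0. *)

Require Import Defs.
From mathcomp Require Import all_boot perm zify.

Set Implicit Arguments.
Unset Strict Implicit.
Unset Printing Implicit Defensive.

(** * Edge colorings as symmetric functions on ordered pairs of vertices *)

Definition color_degree (G : sgraph) (col : G -> G -> nat) (v : G) (i : nat) :=
  #|[set u | adj v u & col v u == i]|.

Lemma mem_edges (G : sgraph) (x y : G) : adj x y -> [set x; y] \in edges G.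
Proof. by move=> xy; apply/imsetP; exists (x, y); rewrite ?inE. Qed.

Lemma edgesP (G : sgraph) (f : {set G}) (v : G) :
  f \in edges G -> v \in f -> exists2 u, adj v u & f = [set v; u].
Proof.
case/imsetP=> -[x y]; rewrite inE /= => xy ->; rewrite !inE => /orP[] /eqP ->; first by exists y.
by exists x; [rewrite adj_sym | rewrite setUC].
Qed.

(** This matches the edges at [v] with the neighbors of [v], so that color classes can be counted
    through neighbors. *)
Lemma set2_injr (T : finType) (v : T) : injective (fun u => [set v; u]).
Proof.
move=> u u' /setP E; move: (E u) (E u'); rewrite !inE !eqxx !orbT.
by case: (u' =P v) => [->|_] /=; [rewrite orbb => /esym/eqP | move=> _ /eqP].
Qed.

Section Coloring.
Variables (G : sgraph) (k : nat) (c : {ffun edge G -> 'I_k}).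
Variable col : G -> G -> nat.
Hypothesis colE : forall (f : edge G) (x y : G),
  adj x y -> val f = [set x; y] -> c f = col x y :> nat.

Lemma card_color_class v i :
  #|[set f in color_class c i | v \in f]| = color_degree col v i.
Proof.
rewrite /color_degree -(card_imset _ (@set2_injr G v)); apply: eq_card => f.
rewrite inE; apply/andP/imsetP.
  case=> /imsetP[g]; rewrite inE => /eqP cg -> vg.
  have [u vu gE] := edgesP (valP g) vg.
  by exists u; rewrite // inE vu -(colE vu gE) cg eqxx.
case=> u; rewrite inE => /andP[vu /eqP cvu] ->; split; last by rewrite !inE eqxx.
apply/imsetP; exists (Sub [set v; u] (mem_edges vu)); last by rewrite SubK.
by rewrite inE; apply/eqP/val_inj; rewrite /= (colE vu) ?SubK.
Qed.

(** A vertex lies in the cover of a color class exactly when some edge of that color meets it, so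
    parity is tested only for colors that occur at the vertex, and empty classes impose nothing. *)
Lemma odd_edge_coloringP :
  odd_edge_coloring c <->
  forall v u, adj v u -> odd (color_degree col v (col v u)).
Proof.
split=> [/forallP oc v u vu | oc].
  pose f : edge G := Sub [set v; u] (mem_edges vu).
  have fE : val f = [set v; u] by rewrite SubK.
  have cf : val f \in color_class c (c f) by apply: imset_f; rewrite inE.
  have /implyP/(_ _)/forallP/(_ v)/implyP := oc (c f).
  rewrite card_color_class (colE vu fE); apply.
    by apply/set0Pn; exists (val f).
  by apply/bigcupP; exists (val f); rewrite // fE !inE eqxx.
apply/forallP=> i; apply/implyP=> _; apply/forallP=> v; apply/implyP.
case/bigcupP=> _ /imsetP[f + ->] vf; rewrite inE => /eqP <-.
have [u vu fE] := edgesP (valP f) vf.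
by rewrite card_color_class (colE vu fE) oc.
Qed.

End Coloring.

(** An edge is a set without a preferred order of its ends, so [pick] chooses one; the symmetry of
    [col] makes the choice irrelevant. The default 0 is never reached on an edge. *)
Lemma odd_edge_colorable_of_fun (G : sgraph) (k : nat) (col : G -> G -> nat) :
  (forall x y, adj x y -> col x y = col y x) ->
  (forall x y, adj x y -> col x y < k.+1) ->
  (forall v u, adj v u -> odd (color_degree col v (col v u))) ->
  odd_edge_colorable G k.+1.
Proof.
move=> colC colk colo.
pose pt (f : edge G) := [pick p : G * G | adj p.1 p.2 && (val f == [set p.1; p.2])].
pose c := [ffun f : edge G => inord (if pt f is Some p then col p.1 p.2 else 0) : 'I_k.+1].
apply/existsP; exists c; apply/(odd_edge_coloringP (col := col)) => // f x y xy fE.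
rewrite ffunE /pt; case: pickP => [[a b] /= /andP[ab /eqP]|/(_ (x, y))]; last first.
  by rewrite /= xy fE eqxx.
rewrite fE => E; rewrite inordK ?colk //.
have : a \in [set x; y] by rewrite E !inE eqxx.
rewrite !inE => /orP[] /eqP aE; subst a; first by rewrite (set2_injr E).
by move: E; rewrite setUC => /set2_injr <-; rewrite colC // adj_sym.
Qed.

Lemma odd_edge_colorable_fun (G : sgraph) (k : nat) :
  odd_edge_colorable G k -> exists col : G -> G -> nat,
  [/\ forall x y, col x y = col y x,
      forall x y, adj x y -> col x y < k &
      forall v u, adj v u -> odd (color_degree col v (col v u))].
Proof.
case/existsP=> c oc.
pose col x y := if insub [set x; y] is Some f then val (c f) else 0.
have colE (f : edge G) x y : adj x y -> val f = [set x; y] -> c f = col x y :> nat.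
  by move=> _ fE; rewrite /col -fE valK.
exists col; split=> [x y|x y xy|]; first by rewrite /col setUC.
  by rewrite -(colE (Sub [set x; y] (mem_edges xy))) ?SubK.
exact/(odd_edge_coloringP colE).
Qed.

(** * Proper edge colorings of bipartite graphs *)

Section ProperColoring.
Variables (T : finType) (k : nat).
Implicit Types (e : rel T) (c : T -> T -> 'I_k).

Definition proper_coloring e c :=
  (forall x y, e x y -> c x y = c y x) /\
  (forall x y z, e x y -> e x z -> c x y = c x z -> y = z).

Lemma missing_color e c x :
  #|[set y | e x y]| < k -> exists a, forall y, e x y -> c x y != a.
Proof.
move=> xk; have /subsetPn[a _ aN] :
    ~~ ([set: 'I_k] \subset [set c x y | y in [set y | e x y]]).
  apply: contraL xk => /subset_leq_card; rewrite cardsT card_ord -leqNgt => le_k.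
  exact: leq_trans le_k (leq_imset_card _ _).
exists a => y xy; apply: contraNneq aN => <-.
by apply: imset_f; rewrite inE.
Qed.

Lemma kempe_swap e c (A : {set T}) (u v : T) (a b : 'I_k) :
  symmetric e -> (forall x y, e x y -> (x \in A) != (y \in A)) ->
  proper_coloring e c -> u \in A -> v \notin A ->
  (forall y, e u y -> c u y != a) -> (forall y, e v y -> c v y != b) ->
  exists c', [/\ proper_coloring e c', forall y, e u y -> c' u y != a &
                 forall y, e v y -> c' v y != a].
Proof.
move=> eC bip [cC cI] uA vA ua vb.
(* Alternating steps leave A along color b and enter it along color a, so that
   each vertex has at most one successor and at most one predecessor; K is the
   a/b-chain of v, and u has no predecessor. *)
pose f x y := e x y && (c x y == if x \in A then b else a).
pose K := [set x | connect f v x].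
have vK : v \in K by rewrite inE connect0.
have fK x y : x \in K -> f x y -> y \in K.
  by move=> + fxy; rewrite !inE => vx; exact: connect_trans vx (connect1 fxy).
have predK x : x \in K -> x != v -> exists2 y, y \in K & f y x.
  rewrite inE => /connectP[p]; case/lastP: p => [|p z]; first by move=> _ -> /eqP.
  rewrite rcons_path last_rcons => /andP[fp fz] -> _; exists (last v p) => //.
  by rewrite inE; apply/connectP; exists p.
have uK : u \notin K.
  apply/negP => /predK[|y _ /andP[yu]]; first by apply: contraNneq vA => <-.
  have := bip _ _ yu; rewrite uA; case: (y \in A) => // _.
  by rewrite cC // => /eqP cuy; have := ua y; rewrite eC yu cuy eqxx => /(_ isT).
(* [K] is closed under every edge colored [a] or [b], not only under steps of [f]: any other such
   edge at [x] has the color by which the chain entered [x], hence leads back to the predecessor. At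
   [v] it would have color [b], which is missing there. *)
have Kedge x y : e x y -> x \in K -> c x y \in [:: a; b] -> y \in K.
  move=> xy xK cab.
  have [fxy|nfxy] := boolP (f x y); first exact: fK fxy.
  have cxy : c x y = if x \in A then a else b.
    by move: nfxy cab; rewrite /f xy !inE; case: (x \in A) => /= /negPf ->; rewrite ?orbF => /eqP.
  have [xv|xv] := eqVneq x v.
    by move: (vb y); rewrite -xv xy cxy xv (negPf vA) eqxx => /(_ isT).
  have [z zK /andP[zx /eqP czx]] := predK x xK xv.
  suff -> : y = z by [].
  apply: (cI x) => //; first by rewrite eC.
  rewrite cxy -cC // czx; have := bip _ _ zx.
  by case: (x \in A); case: (z \in A).
exists (fun x y => if x \in K then tperm a b (c x y) else c x y).
split=> [|y uy|y vy]; last 2 first.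
- by rewrite (negPf uK) ua.
- by rewrite vK (can2_eq (tpermK _ _) (tpermK _ _)) tpermL vb.
split=> [x y xy|x y z xy xz]; last first.
  by case: ifP => _; [move/perm_inj|]; apply: cI.
have yx : e y x by rewrite eC.
(* The swap could break symmetry only on an edge leaving [K]; such an edge has neither color, so the
   transposition fixes its color. *)
have [cab|] := boolP (c x y \in [:: a; b]).
  suff -> : (x \in K) = (y \in K) by rewrite cC.
  by apply/idP/idP => zK; [apply: Kedge cab|apply: (Kedge y); rewrite // -cC].
rewrite !inE negb_or => /andP[ca cb].
by rewrite -(cC x y) // tpermD 1?eq_sym // !if_same.
Qed.

End ProperColoring.

(** Koenig's theorem, by induction on the number of ordered adjacent pairs. After an edge [uv] is
    removed, both ends miss a color; a Kempe swap makes them miss the same color [a], which is then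
    given to [uv]. *)
Lemma bipartite_proper_coloring (T : finType) (k : nat) (e : rel T) (A : {set T}) :
  symmetric e -> (forall x y, e x y -> (x \in A) != (y \in A)) ->
  (forall x, #|[set y | e x y]| <= k.+1) ->
  exists c : T -> T -> 'I_k.+1, proper_coloring e c.
Proof.
have [n] := ubnP #|[set p | e p.1 p.2]|; elim: n e => // n IHn e; rewrite ltnS => le_n eC bip dk.
case: (pickP [pred p | e p.1 p.2 && (p.1 \in A)]) => [[u v] /= /andP[uv uA]|noe]; last first.
  have e0 x y : e x y = false.
    apply/negP => xy; have := noe (x, y); have := noe (y, x).
    by rewrite /= eC xy /=; have := bip _ _ xy; case: (x \in A); case: (y \in A).
  by exists (fun _ _ => ord0); split=> x y; rewrite e0.
have vA : v \notin A by have := bip _ _ uv; rewrite uA; case: (v \in A).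
pose new x y := ((x == u) && (y == v)) || ((x == v) && (y == u)).
pose e' x y := e x y && ~~ new x y.
have newC : symmetric new by move=> x y; rewrite /new orbC (andbC (x == u)) (andbC (x == v)).
have e'C : symmetric e' by move=> x y; rewrite /e' eC newC.
have sub_e x y : e' x y -> e x y by case/andP.
have d' x y : e x y -> new x y -> #|[set z | e' x z]| < k.+1.
  move=> xy nxy; apply: leq_trans (dk x); apply: proper_card.
  apply/properP; split; first by apply/subsetP => z; rewrite !inE => /andP[].
  by exists y; rewrite !inE // /e' nxy andbF.
have [c c_proper] : exists c : T -> T -> 'I_k.+1, proper_coloring e' c.
  apply: IHn => // [|x y /sub_e /bip //|x].
    apply: leq_trans le_n; apply: proper_card.
    apply/properP; split; first by apply/subsetP => z; rewrite !inE => /andP[].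
    by exists (u, v); rewrite !inE //= /e' /new !eqxx andbF.
  by apply: leq_trans (dk x); apply: subset_leq_card; apply/subsetP => z; rewrite !inE => /andP[].
have [a ua] : exists a, forall y, e' u y -> c u y != a.
  by apply/missing_color/(d' u v); rewrite /new ?eqxx.
have [b vb] : exists b, forall y, e' v y -> c v y != b.
  by apply/missing_color/(d' v u); rewrite /new 1?eC ?eqxx ?orbT.
have [|{vb}c' [[c'C c'I] {}ua va]] := kempe_swap e'C _ c_proper uA vA ua vb.
  by move=> x y /sub_e /bip.
have new_c x y z : new x y -> e' x z -> c' x z != a.
  by case/orP => /andP[/eqP -> _]; [apply: ua | apply: va].
exists (fun x y => if new x y then a else c' x y); split=> [x y xy|x y z xy xz].
  by rewrite newC; case: ifP => // nyx; apply: c'C; rewrite /e' xy newC nyx.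
have eN t : e x t -> ~~ new x t -> e' x t by move=> xt nxt; apply/andP.
case: ifPn => nxy; case: ifPn => nxz.
- have uv' : u != v by apply: contraNneq vA => <-.
  case/orP: nxy nxz => /andP[/eqP -> /eqP ->]; rewrite /new eqxx ?(negPf uv') 1?eq_sym ?(negPf uv') /= ?orbF.
    by move/eqP.
  by move/eqP.
- by move/esym/eqP; rewrite (negPf (new_c _ _ _ nxy (eN _ xz nxz))).
- by move/eqP; rewrite (negPf (new_c _ _ _ nxz (eN _ xy nxy))).
- by apply: c'I; apply: eN.
Qed.

(** * Three colors do not suffice: double counting modulo 3 *)

Lemma color_degreeE (G : sgraph) (col : G -> G -> nat) (v : G) (i : nat) :
  color_degree col v i = \sum_u (adj v u && (col v u == i)).
Proof. by rewrite /color_degree -sum1_card big_mkcond; apply: eq_bigr => u _; rewrite inE. Qed.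

Lemma sum_color_degree (G : sgraph) (col : G -> G -> nat) (n : nat) (v : G) :
  (forall u, adj v u -> col v u < n) ->
  \sum_(i < n) color_degree col v i = degree v.
Proof.
move=> coln; rewrite /degree -sum1_card [RHS]big_mkcond.
transitivity (\sum_(i < n) \sum_u (adj v u && (col v u == i))).
  by apply: eq_bigr => i _; apply: color_degreeE.
rewrite exchange_big; apply: eq_bigr => u _; rewrite inE.
case: (boolP (adj v u)) => [vu|_]; last by rewrite big1.
rewrite (bigD1 (Ordinal (coln u vu))) //= eqxx big1 // => i.
by rewrite -val_eqE /= eq_sym => /negPf ->.
Qed.

Lemma not_odd_edge_colorable (G : sgraph) (w : G) (A : {set G}) (k : nat) :
  (forall x y, adj x y -> x != w -> y != w -> (x \in A) != (y \in A)) ->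
  degree w = 4 -> (forall v, v != w -> degree v = 3) -> k <= 3 ->
  ~~ odd_edge_colorable G k.
Proof.
move=> bip w4 v3 k3; apply/negP => /odd_edge_colorable_fun[col [colC colk colo]].
pose F i x y : nat := adj x y && (col x y == i).
have FC i x y : F i x y = F i y x by rewrite /F adj_sym colC.
have cdE x i : color_degree col x i = F i x w + \sum_(y | y != w) F i x y.
  by rewrite color_degreeE (bigD1 w).
have cd_odd x i : color_degree col x i = 0 \/ odd (color_degree col x i).
  case: (posnP (color_degree col x i)) => [|/card_gt0P[y]]; first by left.
  by rewrite inE => /andP[xy /eqP <-]; right; apply: colo.
have cd_sum x : color_degree col x 0 + color_degree col x 1 + color_degree col x 2
                = degree x.
  rewrite -(@sum_color_degree _ col 3) => [|u /colk /leq_trans -> //].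
  by rewrite !big_ord_recr big_ord0.
have cd_mod x i : x != w -> i < 3 ->
    color_degree col x i = color_degree col x 0 %[mod 3].
  move=> xw; have := cd_sum x; rewrite v3 //.
  have := cd_odd x 0; have := cd_odd x 1; have := cd_odd x 2.
  by case: i => [|[|[|]]] //; lia.
(* [a i] and [b i] count the edges of color [i] from [w] into [A] and into its complement, and [E i]
   those between the two sides of [G - w]. *)
pose a i := \sum_(x | (x != w) && (x \in A)) F i x w.
pose b i := \sum_(x | (x != w) && (x \notin A)) F i x w.
pose E i := \sum_(x | (x != w) && (x \in A))
              \sum_(y | (y != w) && (y \notin A)) F i x y.
have sumA i : \sum_(x | (x != w) && (x \in A)) color_degree col x i = a i + E i.
  rewrite -big_split; apply: eq_bigr => x /andP[xw xA]; rewrite cdE; congr (_ + _).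
  rewrite [RHS]big_mkcondr; apply: eq_bigr => y yw; case: ifP => // /negbFE yA.
  by rewrite /F; case: (boolP (adj x y)) => // xy; have := bip _ _ xy xw yw; rewrite xA yA.
have sumB i : \sum_(x | (x != w) && (x \notin A)) color_degree col x i = b i + E i.
  rewrite /E exchange_big -big_split; apply: eq_bigr => x /andP[xw xA]; rewrite cdE.
  congr (_ + _); rewrite [RHS]big_mkcondr; apply: eq_bigr => y yw; rewrite FC.
  case: ifP => // yA.
  by rewrite /F; case: (boolP (adj y x)) => // yx; have := bip _ _ yx yw xw; rewrite (negPf xA) yA.
have ab i : color_degree col w i = a i + b i.
  rewrite cdE {1}/F adj_irrefl add0n (bigID [in A]) /=.
  by congr (_ + _); apply: eq_bigr => x _; rewrite FC.
have modA i : i < 3 -> a i + E i = a 0 + E 0 %[mod 3].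
  move=> i3; rewrite -!sumA -modn_summ -[RHS]modn_summ; congr (_ %% _).
  by apply: eq_bigr => x /andP[xw _]; apply: cd_mod.
have modB i : i < 3 -> b i + E i = b 0 + E 0 %[mod 3].
  move=> i3; rewrite -!sumB -modn_summ -[RHS]modn_summ; congr (_ %% _).
  by apply: eq_bigr => x /andP[xw _]; apply: cd_mod.
(* Modulo 3, [a i - b i] is independent of [i]. It is 0 for the color absent at [w], but 1 or -1 for
   the color occurring there once. *)
have := cd_sum w; rewrite w4.
have := cd_odd w 0; have := cd_odd w 1; have := cd_odd w 2; rewrite !ab.
have := modA 1 isT; have := modA 2 isT; have := modB 1 isT; have := modB 2 isT.
move: (a 0) (a 1) (a 2) (b 0) (b 1) (b 2) (E 0) (E 1) (E 2) => *; lia.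
Qed.

(** * Four colors suffice: extending a proper coloring of [G - w] *)

(** Adjacency in [G - w], kept as a relation on the vertices of [G] to avoid working in the
    subtype. *)
Definition avoiding (G : sgraph) (w : G) : rel G :=
  fun x y => [&& adj x y, x != w & y != w].

Lemma avoiding_sym (G : sgraph) (w : G) : symmetric (avoiding w).
Proof. by move=> x y; rewrite /avoiding adj_sym (andbC (x != w)). Qed.

(** Here [g v] is the color of the edge [wv]. As [c] is proper and [g v] is missing at [v], the
    edges at each vertex other than [w] get distinct colors, so parity has to be checked only at
    [w]. *)
Lemma odd_edge_colorable_extend (G : sgraph) (w : G)
    (c : G -> G -> nat) (g : G -> nat) :
  (forall x y, avoiding w x y -> c x y = c y x) ->
  (forall x y z, avoiding w x y -> avoiding w x z -> c x y = c x z -> y = z) ->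
  (forall x y, avoiding w x y -> c x y < 4) ->
  (forall v, adj w v -> g v < 4) ->
  (forall v y, adj w v -> avoiding w v y -> c v y != g v) ->
  (forall v, adj w v -> odd #|[set u | adj w u & g u == g v]|) ->
  odd_edge_colorable G 4.
Proof.
move=> cC cI c4 g4 cg godd.
pose col x y := if x == w then g y else if y == w then g x else c x y.
apply: (odd_edge_colorable_of_fun (col := col)) => [x y xy|x y xy|v u vu].
- rewrite /col; case: (eqVneq x w) (eqVneq y w) => [xE|xw] [yE|yw] //; first by rewrite xE yE.
  by apply: cC; rewrite /avoiding xy xw.
- rewrite /col; case: (eqVneq x w) (eqVneq y w) => [xE|xw] [yE|yw].
  + by move: xy; rewrite xE yE adj_irrefl.
  + by apply: g4; rewrite -xE.
  + by apply: g4; rewrite -yE adj_sym.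
  + by apply: c4; rewrite /avoiding xy xw.
have [vE|vw] := eqVneq v w.
  by move: vu; rewrite /color_degree /col vE eqxx => /godd.
suff -> : color_degree col v (col v u) = 1 by [].
rewrite /color_degree -(cards1 u); apply: eq_card => y; rewrite !inE.
apply/andP/eqP => [[vy /eqP]|-> //].
rewrite /col (negPf vw).
have av z : adj v z -> z != w -> avoiding w v z by rewrite /avoiding vw => -> ->.
case: (eqVneq y w) (eqVneq u w) => [yE|yw] [uE|uw].
- by rewrite yE uE.
- by move/esym/eqP; rewrite (negPf (cg _ _ _ (av _ vu uw))) // adj_sym -yE.
- by move/eqP; rewrite (negPf (cg _ _ _ (av _ vy yw))) // adj_sym -uE.
- by apply: cI; apply: av.
Qed.

(** Four elements with three possible values have multiplicities 4, 3+1, 2+1+1 or 2+2. In the first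
    three cases [t] is any element, the single one, or one of the repeated pair; the last case is
    the third alternative. *)
Lemma four_values_pattern (T : eqType) (m : T -> nat) (v1 v2 v3 v4 : T) :
  (forall v, m v < 3) ->
  exists t u v x, perm_eq [:: t; u; v; x] [:: v1; v2; v3; v4] /\
    [|| (m u == m v) && (m v == m x), uniq [:: m u; m v; m x]
      | [&& m t == m u, m v == m x & m t != m v]].
Proof.
have m3 v : m v < 3 -> [\/ m v = 0, m v = 1 | m v = 2].
  by case: (m v) => [|[|[|]]] // _; constructor.
move=> mlt.
(* The first four orders let each element be [t]; the first and the last two run through the
   pairings of [v1]. *)
have p1 : perm_eq [:: v1; v2; v3; v4] [:: v1; v2; v3; v4] by [].
have p2 : perm_eq [:: v2; v1; v3; v4] [:: v1; v2; v3; v4] by apply/seq.permP => p /=; lia.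
have p3 : perm_eq [:: v3; v1; v2; v4] [:: v1; v2; v3; v4] by apply/seq.permP => p /=; lia.
have p4 : perm_eq [:: v4; v1; v2; v3] [:: v1; v2; v3; v4] by apply/seq.permP => p /=; lia.
have p5 : perm_eq [:: v1; v3; v2; v4] [:: v1; v2; v3; v4] by apply/seq.permP => p /=; lia.
have p6 : perm_eq [:: v1; v4; v2; v3] [:: v1; v2; v3; v4] by apply/seq.permP => p /=; lia.
have [] := m3 _ (mlt v1) => E1; have [] := m3 _ (mlt v2) => E2;
have [] := m3 _ (mlt v3) => E3; have [] := m3 _ (mlt v4) => E4;
first [ exists v1, v2, v3, v4; split; [exact: p1 | by rewrite E1 E2 E3 E4]
      | exists v2, v1, v3, v4; split; [exact: p2 | by rewrite E1 E2 E3 E4]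
      | exists v3, v1, v2, v4; split; [exact: p3 | by rewrite E1 E2 E3 E4]
      | exists v4, v1, v2, v3; split; [exact: p4 | by rewrite E1 E2 E3 E4]
      | exists v1, v3, v2, v4; split; [exact: p5 | by rewrite E1 E2 E3 E4]
      | exists v1, v4, v2, v3; split; [exact: p6 | by rewrite E1 E2 E3 E4]].
Qed.

Lemma odd_edge_4_colorable (G : sgraph) (w : G) (A : {set G}) :
  (forall x y, adj x y -> x != w -> y != w -> (x \in A) != (y \in A)) ->
  degree w = 4 -> (forall v, v != w -> degree v = 3) ->
  odd_edge_colorable G 4.
Proof.
move=> bip degw deg3.
have sub_adj v : {subset [set y | avoiding w v y] <= [set y | adj v y]}.
  by move=> y; rewrite !inE => /andP[].
have [|x|c3 [cC cI]] := @bipartite_proper_coloring G 2 (avoiding w) A (avoiding_sym w).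
- by move=> x y /and3P[]; apply: bip.
- have [->|/deg3 <-] := eqVneq x w; last exact/subset_leq_card/subsetP.
  by rewrite eq_card0 // => y; rewrite inE /avoiding eqxx andbF.
(* The existential stands outside the implication so that a choice function on all vertices can be
   extracted; [ord0] is a dummy away from the neighbors of [w]. *)
have mP v : exists a : 'I_3, adj w v -> forall y, avoiding w v y -> c3 v y != a.
  have [wv|_] := boolP (adj w v); last by exists ord0.
  have vw : v != w by apply: contraTneq wv => ->; rewrite adj_irrefl.
  have [|a va] := @missing_color _ _ (avoiding w) c3 v; last by exists a.
  rewrite -(deg3 v vw); apply/proper_card/properP; split; first exact/subsetP.
  by exists w; rewrite !inE ?[adj v w]adj_sym // /avoiding eqxx !andbF.
have [m0 m0P] := fin_all_exists mP.
pose m v : nat := m0 v.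
pose c x y : nat := c3 x y.
have m_lt3 v : m v < 3 by apply: ltn_ord.
have c_lt3 x y : c x y < 3 by apply: ltn_ord.
have mN3 v : 3 != m v by rewrite neq_ltn m_lt3 orbT.
have cN3 x y : c x y != 3 by rewrite neq_ltn c_lt3.
have mc v y : adj w v -> avoiding w v y -> c v y != m v by move=> /m0P; apply.
have {}cC x y : avoiding w x y -> c x y = c y x by move/cC => E; rewrite /c E.
have {}cI x y z : avoiding w x y -> avoiding w x z -> c x y = c x z -> y = z.
  by move=> xy xz /val_inj; apply: cI.
have [v1 [v2 [v3 [v4 Nw]]]] :
    exists v1 v2 v3 v4, enum [set u | adj w u] = [:: v1; v2; v3; v4].
  move: degw; rewrite /degree cardE.
  case: (enum _) => [|v1 [|v2 [|v3 [|v4 []]]]] // _.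
  by exists v1, v2, v3, v4.
have [t [u [v [x [nbrs pat]]]]] := four_values_pattern v1 v2 v3 v4 m_lt3.
rewrite -{}Nw in nbrs.
have fiberE (s : seq G) (g : G -> nat) i : perm_eq s (enum [set u | adj w u]) ->
    #|[set u | adj w u & g u == i]| = count_mem i [seq g y | y <- s].
  move=> /seq.permP s_count; rewrite count_map s_count -size_filter.
  rewrite -(card_uniqP (filter_uniq _ (enum_uniq _))).
  by apply: eq_card => y; rewrite !inE mem_filter mem_enum /= inE andbC.
have memE (s : seq G) y : perm_eq s (enum [set u | adj w u]) -> adj w y = (y \in s).
  by move=> E; rewrite (perm_mem E) mem_enum inE.
have uniqE (s : seq G) : perm_eq s (enum [set u | adj w u]) -> uniq s.
  by move=> E; rewrite (perm_uniq E) enum_uniq.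
have one_fresh : (m u == m v) && (m v == m x) || uniq [:: m u; m v; m x] ->
    odd_edge_colorable G 4.
  move=> uvx; pose g y := if y == t then 3 else m y.
  apply: (odd_edge_colorable_extend (w := w) (c := c) (g := g)) => //.
  - by move=> y z _; apply: ltn_trans (c_lt3 y z) _.
  - by move=> y _; rewrite /g; case: ifP => // _; apply: ltn_trans (m_lt3 y) _.
  - by move=> y z wy yz; rewrite /g; case: ifP => _; [apply: cN3 | apply: mc].
  move=> y; rewrite (memE _ _ nbrs) (fiberE _ _ _ nbrs) /= !inE.
  have gt : g t = 3 by rewrite /g eqxx.
  have gE z : z != t -> g z = m z by rewrite /g => /negPf ->.
  have := uniqE _ nbrs; rewrite /= !inE !negb_or -!andbA => /and4P[tu tv tx _].
  have gu : g u = m u by rewrite gE // eq_sym.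
  have gv : g v = m v by rewrite gE // eq_sym.
  have gx : g x = m x by rewrite gE // eq_sym.
  case/or4P => /eqP ->; rewrite gt gu gv gx;
    move: (m u) (m v) (m x) (m_lt3 u) (m_lt3 v) (m_lt3 x) uvx => a b d;
    rewrite /= !inE; clear; lia.
move: pat; rewrite orbA => /orP[/one_fresh // | /and3P[/eqP tu /eqP vx mtv]].
have [c0 [c0_lt3 c0t c0v]] : exists c0, [/\ c0 < 3, c0 != m t & c0 != m v].
  (* The colors 0, 1, 2 sum to 3, so this is the third one. *)
  exists (3 - m t - m v); move: (m t) (m v) (m_lt3 t) (m_lt3 v) mtv => a b *.
  by split; lia.
(* By properness at [x], at most one of [t] and [u] is joined to [x] by an edge of color [c0], and
   the two play symmetric roles. *)
wlog tx : t u tu nbrs c0t mtv {one_fresh} /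
    ~~ (avoiding w x t && (c x t == c0)) => [IH|].
  have [/andP[xt /eqP cxt]|] := boolP (avoiding w x t && (c x t == c0)).
    apply: (IH u t); rewrite -?tu //.
      by apply: perm_trans nbrs; apply/seq.permP => p /=; lia.
    apply/negP => /andP[xu /eqP cxu]; have := uniqE _ nbrs.
    by rewrite (cI x t u) ?cxt //= inE eqxx.
  exact: (IH t u).
have := uniqE _ nbrs; rewrite /= !inE !negb_or -!andbA.
case/and5P=> t_u t_v t_x u_v /and3P[u_x v_x _].
pose g y := if y == t then 3 else if y == x then c0 else m y.
pose c' y z := if ((y == x) || (z == x)) && (c y z == c0) then 3 else c y z.
have gE y : y != t -> y != x -> g y = m y by rewrite /g => /negPf -> /negPf ->.
(* Since [c] never uses 3, the value 3 of [c'] can only stand for [c0]; hence [c'] inherits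
   properness from [c]. *)
have c'_inj y z z' : c' y z = c' y z' -> c y z = c y z'.
  rewrite /c'; case: ifP => [/andP[_ /eqP ->]|_].
    by case: ifP => [/andP[_ /eqP ->]|_] // /esym/eqP; rewrite (negPf (cN3 _ _)).
  by case: ifP => // _ /eqP; rewrite (negPf (cN3 _ _)).
apply: (odd_edge_colorable_extend (w := w) (c := c') (g := g)).
- by move=> y z yz; rewrite /c' (cC y z yz) orbC.
- by move=> y z z' yz yz' /c'_inj; apply: cI.
- by move=> y z _; rewrite /c'; case: ifP => // _; apply: ltn_trans (c_lt3 y z) _.
- move=> y _; rewrite /g; case: ifP => // _; case: ifP => _.
    exact: ltn_trans c0_lt3 _.
  exact: ltn_trans (m_lt3 y) _.
(* At [t], color 3 could only come from a recolored edge to [x], excluded by [tx]. At [x], color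
   [c0] has been recolored away. At [u] and [v], a recolored edge gets 3, which differs from
   [m y]. *)
- move=> y z wy yz.
  have [yt|yt] := eqVneq y t.
    rewrite /g /c' yt eqxx (negPf t_x) /=; case: ifP => [|_]; last exact: cN3.
    case/andP=> /eqP zx ctz; case/negP: tx.
    by rewrite -zx avoiding_sym -yt yz cC ?yt // avoiding_sym -yt.
  have [yx|yx] := eqVneq y x.
    rewrite /g (negPf yt) yx eqxx /c' eqxx /=.
    by case: ifP => [_|->] //; rewrite neq_ltn c0_lt3 orbT.
  by rewrite gE // /c'; case: ifP => _; [apply: mN3 | apply: mc].
- move=> y; rewrite (memE _ _ nbrs) (fiberE _ _ _ nbrs) => y_nbr.
  rewrite count_uniq_mem; first by rewrite map_f.
  have gt : g t = 3 by rewrite /g eqxx.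
  have gx : g x = c0 by rewrite /g eqxx eq_sym (negPf t_x).
  have gu : g u = m u by rewrite gE // eq_sym.
  have gv : g v = m v by rewrite gE // eq_sym.
  rewrite /= gt gu gv gx !inE !negb_or !mN3 -tu mtv.
  by rewrite -!(eq_sym c0) c0t c0v neq_ltn c0_lt3.
Qed.

(** * The odd chromatic index from the two bounds *)

Theorem theorem2p1 (G : sgraph) (w : G) :
  connected G ->
  bipartite (del_vertex w) ->
  degree w = 4 ->
  (forall v : G, v != w -> degree v = 3) ->
  (exists X Y : {set del_vertex w},
     [/\ bipartition X Y,
         #|[set x in X | adj w (val x)]| = 2 &
         #|[set y in Y | adj w (val y)]| = 2]) ->
  odd_chromatic_index G = 4.
Proof.
move=> _ [X [Y [_ disjXY XY]]] degw deg3 _.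
(* Both bounds describe the bipartition by one set of vertices of [G], so [X] is pushed forward
   along [val]. *)
have bip x y : adj x y -> x != w -> y != w ->
    (x \in [set val z | z in X]) != (y \in [set val z | z in X]).
  move=> xy xw yw; pose x' : del_vertex w := Sub x xw; pose y' : del_vertex w := Sub y yw.
  have -> : x = val x' by rewrite SubK.
  have -> : y = val y' by rewrite SubK.
  rewrite !(mem_imset _ _ val_inj).
  by case/orP: (XY x' y' xy) => /andP[] => [-> /(disjointFl disjXY) -> | /(disjointFl disjXY) -> ->].
rewrite /odd_chromatic_index; case: ex_minnP => n coln min_n.
apply/eqP; rewrite eqn_leq min_n; last exact: odd_edge_4_colorable bip degw deg3.
rewrite ltnNge; apply: contraL coln; exact: not_odd_edge_colorable bip degw deg3.
Qed.
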